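(* Let $p$ be an odd prime and let $P$ be a finite non-abelian metacyclic $p$-group. Then: (a) Every splittable metacyclic factorization $P=SK$ has the same $|K|$ (that is, $|K|$ depends only on $P$), namely $|K|=\exp(P)$ or $|K|=\frac{|P|}{\exp(P)}$. (b) Every non-splittable metacyclic factorization $P=SK$ has the same $|S|$, namely $|S|=\exp(P)$.
   Context: $\exp(G)$ denotes the exponent of a finite group $G$. A metacyclic structure of a finite group $G$ is a cyclic normal subgroup $K\trianglelefteq G$ such that $G/K$ is also cyclic; $G$ is metacyclic if it has a metacyclic structure. A metacyclic factorization $G=SK$ is a metacyclic structure $K\trianglelefteq G$ together with a cyclic subgroup $S$ of $G$ such that $K$ and $S$ together generate $G$. It is called split if $S\cap K$ is trivial (i.e. $G=K\rtimes S$), otherwise non-split. A metacyclic factorization $G=SK$ is called - splittable if there is a cyclic subgroup $R$ of $G$ (possibly $R=S$) such that $G=RK$ is a split metacyclic factorization; - non-splittable if every metacyclic factorization $G=RK$ with the given $K$ is non-split. *)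

(* Defs.v *)
From mathcomp Require Import all_boot all_fingroup all_solvable.

Set Implicit Arguments.
Unset Strict Implicit.
Unset Printing Implicit Defensive.

Import GroupScope.

Section MetacyclicFactorization.

Variable gT : finGroupType.
Implicit Types G S K : {group gT}.

Definition metacyclic_structure G K : bool :=
  [&& K <| G, cyclic K & cyclic (G / K)].

Definition metacyclic_factorization G S K : bool :=
  [&& metacyclic_structure G K, S \subset G, cyclic S & S <*> K == G].

Definition split_factorization G S K : bool :=
  metacyclic_factorization G S K && (S :&: K == 1).

Definition splittable_factorization G S K : bool :=
  metacyclic_factorization G S K
  && [exists R : {group gT}, split_factorization G R K].

Definition nonsplittable_factorization G S K : bool :=
  metacyclic_factorization G S K
  && [forall R : {group gT},
        metacyclic_factorization G R K ==> ~~ split_factorization G R K].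

End MetacyclicFactorization.

(* Main.v *)
Require Import Defs.
From mathcomp Require Import all_boot all_fingroup all_solvable zify.

Set Implicit Arguments.
Unset Strict Implicit.
Unset Printing Implicit Defensive.

(** Let [P = SK] with [K = <a>] normal and [S = <b>].  Since [P] is a p-group,
    [a ^ b = a ^+ r] with [r] congruent to 1 modulo [p], and for an odd prime
    [p] the geometric sum [1 + r + ... + r ^ (p ^ e - 1)] is [p ^ e] times an
    integer prime to [p].  Hence
      [(b * a ^+ i) ^+ (p ^ e) = b ^+ (p ^ e) * a ^+ (i * p ^ e * u)]
    with [u] prime to [p] and independent of [i] ([expMg_pfactor]).  Two facts
    follow.
    - No element of [P] has larger order than both [a] and [b], so that
      [exponent P = maxn #|S| #|K|] ([exponent_metacyclic_factorization]).
    - If [#|S| <= #|K|], an [i] can be chosen so that the right-hand side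
      vanishes for [p ^ e = #|P / K|]; then [b * a ^+ i] generates a complement
      of [K] ([splittable_of_card_le]).
    The second fact says that a non-splittable factorization has
    [#|S| > #|K|], and the first that then [#|S| = exponent P].

    If [R] is a complement of [K], then [#|R| * #|K| = #|P|] while the larger
    of the two orders is the exponent, which leaves two values for [#|K|].
    Both cannot occur in the same non-abelian [P], because the exponent of
    [P / P^`(1)] separates them: this quotient contains a copy of each
    complement, so its exponent is at least [exponent P] when some complement
    has that order, whereas a factorization with [#|S| < #|K|] forces the
    exponent of [P / P^`(1)] below [#|K| = exponent P], the nontrivial group
    [P^`(1)] being contained in [K] ([card_split_kernel_le]). *)

(** * Geometric sums with ratio congruent to 1 modulo p *)

Lemma geometric_sumD r m n :
  \sum_(k < m + n) r ^ k = \sum_(k < m) r ^ k + r ^ m * \sum_(k < n) r ^ k.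
Proof.
rewrite big_split_ord /= big_distrr /=; congr (_ + _).
by apply: eq_bigr => k _; rewrite expnD.
Qed.

Lemma geometric_sumM r m n :
  \sum_(k < m * n) r ^ k = (\sum_(k < m) r ^ k) * \sum_(k < n) (r ^ m) ^ k.
Proof.
elim: n => [|n IHn]; first by rewrite muln0 !big_ord0 muln0.
rewrite mulnS addnC geometric_sumD IHn big_ord_recr /= mulnDr -expnM.
by congr (_ + _); apply: mulnC.
Qed.

(** Modulo [p ^ 2] the power [(1 + p * t) ^ k] is [1 + p * t * k], and the sum
    of the [k < n] is ['C(n, 2)]. *)
Lemma geometric_sum_modsquare p t n :
  exists q, \sum_(k < n) (1 + p * t) ^ k = n + p * t * 'C(n, 2) + p ^ 2 * q.
Proof.
elim: n => [|n [q IHn]].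
  by exists 0; rewrite big_ord0 bin0n !muln0.
exists (q * (1 + p * t) + t ^ 2 * 'C(n, 2)).
rewrite -add1n geometric_sumD big_ord1 expn0 expn1 IHn add1n binS bin1 -!mulnn.
by nia.
Qed.

(** This is where [p] must be odd: the first order term of the sum vanishes
    modulo [p ^ 2] because [p] divides ['C(p, 2)]. *)
Lemma geometric_sum_prime p t : prime p -> odd p ->
  exists w, \sum_(k < p) (1 + p * t) ^ k = p * (1 + p * w).
Proof.
move=> p_pr p_odd; have [q ->] := geometric_sum_modsquare p t p.
have /dvdnP[c ->]: p %| 'C(p, 2).
  by apply: prime_dvd_bin => //=; apply: odd_prime_gt2.
by exists (t * c + q); rewrite -mulnn; nia.
Qed.

(** The sum of length [p ^ e * p] is the product of the sum of length [p ^ e]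
    by a sum of length [p] whose ratio [r ^ (p ^ e)] is again 1 modulo [p];
    each such factor contributes exactly one power of [p]. *)
Lemma geometric_sum_pfactor p t e : prime p -> odd p ->
  exists2 u, coprime p u & \sum_(k < p ^ e) (1 + p * t) ^ k = p ^ e * u.
Proof.
move=> p_pr p_odd; elim: e => [|e [u co_pu IHe]].
  by exists 1; rewrite ?coprimen1 // big_ord1.
have [t' Dt']: exists t', (1 + p * t) ^ (p ^ e) = 1 + p * t'.
  elim: (p ^ e) => [|n [t' IHn]]; first by exists 0; rewrite muln0.
  by exists (t' + t + p * t * t'); rewrite expnS IHn; nia.
have [w Dw] := geometric_sum_prime t' p_pr p_odd.
exists (u * (1 + p * w)).
  by rewrite coprimeMr co_pu /= addnC mulnC /coprime gcdnMDl gcdn1.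
by rewrite expnSr geometric_sumM IHe Dt' Dw; nia.
Qed.

(** * Powers in a cyclic extension of a cyclic normal subgroup *)

Import GroupScope.

Lemma expMg_conj_power (gT : finGroupType) (a b : gT) r i n :
  a ^ b = a ^+ r ->
  (b * a ^+ i) ^+ n = b ^+ n * a ^+ (i * \sum_(k < n) r ^ k).
Proof.
move=> Dab; elim: n => [|n IHn].
  by rewrite big_ord0 muln0 !expg0 mulg1.
have ->: \sum_(k < n.+1) r ^ k = (1 + r * \sum_(k < n) r ^ k)%N.
  by rewrite -add1n geometric_sumD big_ord1 expn0 expn1.
rewrite expgSr IHn mulgA -(mulgA (b ^+ n)) (conjgC _ b) conjXg Dab -expgM.
rewrite (mulgA (b ^+ n)) -expgSr -mulgA -expgD.
by congr (_ * a ^+ _); nia.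
Qed.

(** In a nilpotent group the commutator [[~ a, b]] lies in a proper subgroup
    of [<[a]>], so it is not a generator: its exponent as a power of [a] is
    divisible by [p]. *)
Lemma conjg_power_1mod (gT : finGroupType) (p : nat) (G : {group gT}) (a b : gT) :
    prime p -> p.-group G -> a \in G -> b \in 'N_G(<[a]>) ->
  exists t, a ^ b = a ^+ (1 + p * t).
Proof.
move=> p_pr pG Ga Nb.
have [->|nta] := eqVneq a 1; first by exists 0%N; rewrite conj1g expg1n.
have sKN: <[a]> \subset 'N_G(<[a]>) by rewrite subsetI cycle_subG Ga normG.
have pN: p.-group 'N_G(<[a]>) by apply: pgroupS pG; apply: subsetIl.
have ltRK: [~: <[a]>, 'N_G(<[a]>)] \proper <[a]>.
  rewrite (nil_comm_properl (pgroup_nil pN)) ?cycle_eq1 //.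
  by rewrite subsetI subxx subsetIr.
have Rab: [~ a, b] \in [~: <[a]>, 'N_G(<[a]>)] by rewrite mem_commg ?cycle_id.
have /cycleP[j Dj]: [~ a, b] \in <[a]> by apply: (subsetP (proper_sub ltRK)).
suffices /dvdnP[t Dt]: (p %| j)%N.
  by exists t; rewrite conjg_mulR Dj Dt mulnC expgD expg1.
apply: contraLR ltRK; rewrite -prime_coprime // => co_pj.
have gen_j: generator <[a]> (a ^+ j).
  rewrite generator_coprime; have /p_natP[e ->] := mem_p_elt pG Ga.
  exact: coprimeXl.
rewrite properE negb_and negbK; apply/orP; right.
by rewrite {1}(eqP gen_j) cycle_subG -Dj.
Qed.

Lemma expMg_pfactor (gT : finGroupType) (p e : nat) (G : {group gT}) (a b : gT) :
    prime p -> odd p -> p.-group G -> a \in G -> b \in 'N_G(<[a]>) ->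
  exists2 u, coprime p u &
    forall i, (b * a ^+ i) ^+ (p ^ e) = b ^+ (p ^ e) * a ^+ (i * (p ^ e * u)).
Proof.
move=> p_pr p_odd pG Ga Nb.
have [t Dab] := conjg_power_1mod p_pr pG Ga Nb.
have [u co_pu Du] := geometric_sum_pfactor t e p_pr p_odd.
by exists u => // i; rewrite (expMg_conj_power _ _ Dab) Du.
Qed.

(** * Metacyclic factorizations of p-groups of odd order *)

Section Factorizations.

Variables (gT : finGroupType) (p : nat) (P : {group gT}).
Hypotheses (p_pr : prime p) (p_odd : odd p) (pP : p.-group P).
Implicit Types S K R : {group gT}.

(** Every element has the form [b * a ^+ i] with [b] in [S] and [a] a fixed
    generator of [K], and a power of [p] that annihilates both [S] and [K]
    annihilates [b * a ^+ i] by [expMg_pfactor]. *)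
Lemma exponent_metacyclic_factorization S K :
  metacyclic_factorization P S K -> exponent P = maxn #|S| #|K|.
Proof.
case/and4P=> /and3P[nsKP cycK _] sSP cycS /eqP defP.
have [sKP nKP] := andP nsKP.
have nKS := subset_trans sSP nKP.
apply/eqP; rewrite eqn_dvd; apply/andP; split; last first.
  rewrite -(exponent_cyclic cycS) -(exponent_cyclic cycK).
  by case: (leqP (exponent S)) => _; apply: exponentS.
have [m Dm]: exists m, maxn #|S| #|K| = (p ^ m)%N.
  have [n Dn] := p_natP (pgroupS sSP pP).
  by have [k Dk] := p_natP (pgroupS sKP pP); case: leqP => _; [exists k | exists n].
have dvdm H : p.-group H -> #|H| <= p ^ m -> #|H| %| p ^ m.
  case/p_natP=> n ->; rewrite leq_exp2l ?dvdn_Pexp2l ?prime_gt1 //.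
have dvdS : #|S| %| p ^ m by rewrite dvdm ?(pgroupS sSP) // -Dm leq_maxl.
have dvdK : #|K| %| p ^ m by rewrite dvdm ?(pgroupS sKP) // -Dm leq_maxr.
rewrite Dm; apply/exponentP=> x; rewrite -defP norm_joinEl //.
have [a defK] := cyclicP cycK.
case/mulsgP=> b k Sb; rewrite defK => /cycleP[i ->] ->.
have Ka: a \in K by rewrite defK cycle_id.
have Nb: b \in 'N_P(<[a]>).
  by rewrite inE (subsetP sSP) // -defK (subsetP nKS).
have [u _ ->] := expMg_pfactor m p_pr p_odd pP (subsetP sKP a Ka) Nb.
rewrite -(expg_mod_order b) (eqP (dvdn_trans (order_dvdG Sb) dvdS)) mul1g.
by apply/eqP; rewrite -order_dvdn mulnCA dvdn_mulr // (dvdn_trans (order_dvdG Ka)).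
Qed.

(** A generator [b] of [S] is corrected by a power of [a] into a generator of
    a complement.  With [p ^ n = #|P / K|], the condition on orders makes
    [b ^+ (p ^ n)] a [p ^ n]-th power of an element of [K], and this is
    exactly what the factor [a ^+ (i * (p ^ n * u))] can cancel. *)
Lemma splittable_of_card_le S K :
    metacyclic_factorization P S K -> #|S| <= #|K| ->
  splittable_factorization P S K.
Proof.
move=> facSK leSK; rewrite /splittable_factorization facSK /=.
case/and4P: facSK => strK sSP cycS /eqP defP.
case/and3P: (strK) => nsKP cycK _.
have [sKP nKP] := andP nsKP.
have [a defK] := cyclicP cycK; have [b defS] := cyclicP cycS.
have Sb : b \in S by rewrite defS cycle_id.
have Ka : a \in K by rewrite defK cycle_id.
have Pa := subsetP sKP a Ka; have Pb := subsetP sSP b Sb.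
have Nb := subsetP nKP b Pb.
have [n Dn] := p_natP (quotient_pgroup K pP).
have [u co_pu Du]: exists2 u, coprime p u & forall i,
    (b * a ^+ i) ^+ (p ^ n) = b ^+ (p ^ n) * a ^+ (i * (p ^ n * u)).
  by apply: (expMg_pfactor _ p_pr p_odd pP); rewrite // inE Pb -defK.
have Kbn: b ^+ (p ^ n) \in K.
  apply: coset_idr; first exact: groupX.
  by rewrite morphX // -Dn expg_cardG ?mem_quotient.
have dvdSK: #|S| %| #|K|.
  have [k Dk] := p_natP (pgroupS sKP pP); have [s Ds] := p_natP (pgroupS sSP pP).
  by move: leSK; rewrite Dk Ds leq_exp2l ?dvdn_Pexp2l ?prime_gt1.
have defQ : P / K = S / K by rewrite -defP quotientYidr // (subset_trans sSP).
have dvdnK: p ^ n %| #|K|.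
  by rewrite -Dn defQ (dvdn_trans (dvdn_quotient _ _)).
(* Since b ^+ #|K| = 1, the power b ^+ (p ^ n) is annihilated by the cofactor
   of p ^ n in #|K|. *)
have [j Dj]: exists j, b ^+ (p ^ n) = a ^+ (j * p ^ n).
  have /cycleP[j Dj]: b ^+ (p ^ n) \in <[a]> by rewrite -defK.
  suffices /dvdnP[j' Dj']: p ^ n %| j by exists j'; rewrite Dj Dj'.
  have K_gt0 := cardG_gt0 K.
  case/dvdnP: dvdnK => c Dc.
  have: a ^+ (j * c) = 1.
    rewrite expgM -Dj -expgM mulnC -Dc; apply/eqP; rewrite -order_dvdn.
    by rewrite (dvdn_trans (order_dvdG Sb)).
  move/eqP; rewrite -order_dvdn orderE -defK Dc mulnC dvdn_pmul2r //.
  by move: K_gt0; rewrite Dc muln_gt0 => /andP[].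
(* As u is prime to p, a ^+ u generates K and so has a ^- j as a power. *)
have [i Di]: exists i, a ^+ (u * i) = a ^- j.
  have /cycleP[i Di]: a ^- j \in <[a ^+ u]>.
    have gen_u: generator <[a]> (a ^+ u).
      rewrite generator_coprime; have /p_natP[e ->] := mem_p_elt pP Pa.
      exact: coprimeXl.
    by rewrite -(eqP gen_u) groupV mem_cycle.
  by exists i; rewrite expgM.
pose c := b * a ^+ i.
have cn1: c ^+ (p ^ n) = 1.
  have De: (i * (p ^ n * u) = u * i * p ^ n)%N by rewrite mulnCA mulnC (mulnC i).
  by rewrite Du Dj De expgM (expgM a (u * i)) Di expVgn mulgV.
have Pc: c \in P by rewrite groupM ?groupX.
have defRK: <[c]> <*> K = P.
  apply/eqP; rewrite eqEsubset join_subG cycle_subG Pc sKP -defP join_subG.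
  rewrite joing_subr andbT defS cycle_subG.
  rewrite -[b](mulgK (a ^+ i)) groupM ?groupV //.
    by rewrite mem_gen // inE cycle_id.
  by rewrite groupX // mem_gen // inE Ka orbT.
apply/existsP; exists <[c]>%G; rewrite /split_factorization.
rewrite /metacyclic_factorization strK cycle_subG Pc cycle_cyclic defRK eqxx /=.
have nKR: <[c]> \subset 'N(K) by rewrite cycle_subG (subsetP nKP).
rewrite trivg_card_le1.
(* The order of c is at most the index of K, so that <[c]> can only reach the
   order of P in a product with K if it meets K trivially. *)
have leR: #|<[c]>| <= #|P / K|.
  by rewrite Dn dvdn_leq ?expn_gt0 ?prime_gt0 // -orderE order_dvdn cn1.
have := mul_cardG <[c]> K; rewrite -norm_joinEl // defRK => cardRK.
rewrite -(leq_pmul2l (cardG_gt0 P)) -cardRK muln1 -(Lagrange sKP).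
by rewrite -card_quotient // mulnC leq_pmul2l.
Qed.

(** The derived subgroup lies in [K], hence meets [S] trivially, and [S]
    embeds in the abelianization. *)
Lemma card_split_dvd_abelianization S K :
  split_factorization P S K -> #|S| %| exponent (P / P^`(1)).
Proof.
case/andP=> /and4P[/and3P[nsKP _ cycPK] sSP cycS _] tiSK.
have sP'K: P^`(1) \subset K by rewrite der1_min ?normal_norm ?cyclic_abelian.
have tiSP': S :&: P^`(1) = 1.
  by apply/trivgP; rewrite -(eqP tiSK) setIS.
have nP'S: S \subset 'N(P^`(1)) := subset_trans sSP (der_norm 1 P).
rewrite (card_isog (quotient_isog nP'S _)) ?(setIC _ S) //.
rewrite -exponent_cyclic ?quotient_cyclic //.
by rewrite exponentS ?quotientS.
Qed.

(** The abelianization is generated by the images of [S] and [K], and both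
    have order less than [#|K|]: the first by hypothesis, the second because
    [K] contains the nontrivial subgroup [P^`(1)]. *)
Lemma exponent_abelianization_lt S K :
    ~~ abelian P -> metacyclic_factorization P S K -> #|S| < #|K| ->
  exponent (P / P^`(1)) < #|K|.
Proof.
move=> nabP /and4P[/and3P[nsKP cycK cycPK] sSP cycS /eqP defP] ltSK.
have [sKP nKP] := andP nsKP.
have sP'K: P^`(1) \subset K by rewrite der1_min ?cyclic_abelian.
have nP'P := der_norm 1 P.
have nP'K := subset_trans sKP nP'P; have nP'S := subset_trans sSP nP'P.
have ntP': P^`(1) != 1 by apply: contra nabP => /eqP/derG1P.
have [[|m] Dm] := p_natP (pgroupS sKP pP).
  by move: ltSK; rewrite Dm ltnNge cardG_gt0.
have dvdm (rT : finGroupType) (H : {group rT}) :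
    p.-group H -> #|H| < p ^ m.+1 -> #|H| %| p ^ m.
  by case/p_natP=> n ->; rewrite ltn_exp2l ?dvdn_Pexp2l ?prime_gt1.
suffices: exponent (P / P^`(1)) %| p ^ m.
  move/dvdn_leq=> le_m; rewrite Dm (leq_ltn_trans (le_m _)) //.
    by rewrite expn_gt0 prime_gt0.
  by rewrite ltn_exp2l ?prime_gt1.
have dvdS: #|S / P^`(1)| %| p ^ m.
  by rewrite (dvdn_trans (dvdn_quotient _ _)) // dvdm ?(pgroupS sSP) // -Dm.
have dvdK: #|K / P^`(1)| %| p ^ m.
  by rewrite dvdm ?quotient_pgroup ?(pgroupS sKP) // -Dm ltn_quotient.
have abPP': abelian (P / P^`(1)) := der_abelian 0 P.
have defQ: P / P^`(1) = (S / P^`(1)) <*> (K / P^`(1)).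
  by rewrite -quotientY // defP.
apply/exponentP=> x; rewrite defQ cent_joinEl; last first.
  by apply: subset_trans (subset_trans abPP' (centS _)); rewrite quotientS.
case/mulsgP=> y z Sy Kz ->.
have Py: y \in P / P^`(1) by apply: subsetP Sy; rewrite quotientS.
have Pz: z \in P / P^`(1) by apply: subsetP Kz; rewrite quotientS.
rewrite expgMn; last exact: (centsP abPP').
have killed (H : {group coset_of P^`(1)}) h :
    h \in H -> #|H| %| p ^ m -> h ^+ (p ^ m) = 1.
  by move=> Hh dvdH; apply/eqP; rewrite -order_dvdn (dvdn_trans (order_dvdG Hh)).
by rewrite (killed _ y Sy dvdS) (killed _ z Kz dvdK) mulg1.
Qed.

Lemma card_split_factorization S K :
  split_factorization P S K -> (#|S| * #|K|)%N = #|P|.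
Proof.
case/andP=> /and4P[/and3P[nsKP _ _] sSP _ /eqP defP] /eqP tiSK.
rewrite mul_cardG tiSK cards1 muln1 -norm_joinEl ?defP //.
exact: subset_trans sSP (normal_norm nsKP).
Qed.

(** If [#|K2| < #|K1|], then [#|S1| < #|S2|] since both products are [#|P|];
    both maxima being [exponent P], this leaves only
    [#|S1| < #|K1| = #|S2|].  But then the exponent of [P / P^`(1)] is less
    than [#|K1|] and a multiple of [#|S2|]. *)
Lemma card_split_kernel_le S1 K1 S2 K2 :
    ~~ abelian P -> split_factorization P S1 K1 -> split_factorization P S2 K2 ->
  #|K1| <= #|K2|.
Proof.
move=> nabP split1 split2; rewrite leqNgt; apply/negP=> ltK21.
have card1 := card_split_factorization split1.
have card2 := card_split_factorization split2.
have [fac1 _] := andP split1; have [fac2 _] := andP split2.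
have exp1 := exponent_metacyclic_factorization fac1.
have exp2 := exponent_metacyclic_factorization fac2.
have K2_gt0 := cardG_gt0 K2; have S1_gt0 := cardG_gt0 S1.
have ltS12: #|S1| < #|S2|.
  by rewrite -(ltn_pmul2r K2_gt0) card2 -card1 ltn_pmul2l.
have expE: maxn #|S1| #|K1| = maxn #|S2| #|K2| by rewrite -exp1.
have [ltSK1 eqSK]: #|S1| < #|K1| /\ #|S2| = #|K1|.
  by clear -ltK21 ltS12 expE; lia.
have := exponent_abelianization_lt nabP fac1 ltSK1.
have := dvdn_leq (exponent_gt0 _) (card_split_dvd_abelianization split2).
by rewrite eqSK => /leq_ltn_trans lt /lt; rewrite ltnn.
Qed.

End Factorizations.

Theorem corollary1p4 (gT : finGroupType) (p : nat) (P : {group gT})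
    (p_prime : prime p) (p_odd : odd p) (pP : p.-group P)
    (P_nonabelian : ~~ abelian P) (P_metacyclic : metacyclic P) :
  ((forall S1 K1 S2 K2 : {group gT},
      splittable_factorization P S1 K1 ->
      splittable_factorization P S2 K2 ->
      #|K1| = #|K2|)
   /\ (forall S K : {group gT},
         splittable_factorization P S K ->
         #|K| = exponent P \/ #|K| = (#|P| %/ exponent P)%N))
  /\ ((forall S1 K1 S2 K2 : {group gT},
      nonsplittable_factorization P S1 K1 ->
      nonsplittable_factorization P S2 K2 ->
      #|S1| = #|S2|)
     /\ (forall S K : {group gT},
        nonsplittable_factorization P S K ->
        #|S| = exponent P)).
Proof.
have expS S K : nonsplittable_factorization P S K -> #|S| = exponent P.
  case/andP=> facSK /forallP nsplit.
  rewrite (exponent_metacyclic_factorization p_prime p_odd pP facSK).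
  case: leqP => // leSK.
  have /andP[_ /existsP[R splitR]] :=
    splittable_of_card_le p_prime p_odd pP facSK leSK.
  by case/andP: (splitR) (nsplit R) => -> _; rewrite splitR.
split; split=> [S1 K1 S2 K2 | S K].
- case/andP=> _ /existsP[R1 split1] /andP[_ /existsP[R2 split2]].
  have leK := card_split_kernel_le p_prime p_odd pP P_nonabelian.
  apply/eqP; rewrite eqn_leq (leK _ _ _ _ split1 split2).
  exact: leK split2 split1.
- case/andP=> _ /existsP[R splitR]; have [facR _] := andP splitR.
  rewrite (exponent_metacyclic_factorization p_prime p_odd pP facR).
  rewrite -(card_split_factorization splitR).
  by case: leqP => _; [left | right; rewrite mulKn].
- by move=> /expS-> /expS->.
- exact: expS.
Qed.
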